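(* Let $E$ be a quasi-$(DF)$-space. (i) If the strong dual $E'_\beta$ is separable, then $E_w$ is cosmic. (ii) If $E'_\beta$ is separable and barrelled, then $E_w$ is an $\aleph_0$-space. (iii) If $E$ is a strict $(LF)$-space such that $E'_\beta$ is separable, then $E_w$ is an $\aleph_0$-space.
   Context: Order $\mathbb{N}^{\mathbb{N}}$ pointwise. A resolution is a family $\{A_\alpha:\alpha\in\mathbb{N}^{\mathbb{N}}\}$ covering a set with $A_\alpha\subseteq A_\beta$ whenever $\alpha\le\beta$. A locally convex space $E$ is a quasi-$(DF)$-space if (a) it has a resolution of bounded sets such that every bounded subset of $E$ lies in some member, and (b) there is a resolution of $(E',\sigma(E',E))$ such that every sequence in each member is equicontinuous. $E_w$ is $E$ with its weak topology $\sigma(E,E')$; $E'_\beta$ is $E'$ with the strong topology $\beta(E',E)$. A Tychonoff space is cosmic if it is a continuous image of a separable metric space, and an $\aleph_0$-space if it is the image of a separable metric space under a continuous compact-covering map (every compact subset of the image is the image of a compact set). A strict $(LF)$-space is the locally convex inductive limit of an increasing sequence $(E_n,\tau_n)$ of Fréchet spaces with $E=\bigcup_nE_n$ and $\tau_{n+1}|_{E_n}=\tau_n$. *)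

(* Defs.v *)
From HB Require Import structures.
From mathcomp Require Import all_boot all_order all_algebra.
From mathcomp Require Import all_classical all_reals all_analysis.
Unset Printing Implicit Defensive.
Import Order.TTheory GRing.Theory Num.Theory.
Import numFieldTopology.Exports numFieldNormedType.Exports.
Local Open Scope classical_set_scope.
Local Open Scope ring_scope.

Section lcs_defs.
Context {R : realType}.

Definition linear_map {U V : lmodType R} (f : U -> V) :=
  forall (a : R) (x y : U), f (a *: x + y) = a *: f x + f y.

Definition linear_functional {E : tvsType R} (f : E -> R) :=
  forall (a : R) (x y : E), f (a *: x + y) = a * f x + f y.

Definition topdual (E : tvsType R) : set (E -> R) :=
  [set f | linear_functional f /\ continuous f].

Definition tvs_bounded {E : tvsType R} (B : set E) :=
  forall U : set E, nbhs 0 U ->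
    exists2 r : R, 0 < r & forall t : R, r <= `|t| -> B `<=` [set t *: x | x in U].

Definition strong_dual (E : tvsType R) :=
  set_type (topdual E : set {family (@tvs_bounded E), E -> R}).

Definition weak_space (E : tvsType R) :=
  initial_topology (fun x : E => (fun phi : set_type (topdual E) => set_val phi x)
     : {ptws set_type (topdual E) -> R}).

HB.instance Definition _ (E : tvsType R) :=
  Topological.on (strong_dual E).
HB.instance Definition _ (E : tvsType R) :=
  Topological.on (weak_space E).

Definition absolutely_convex {E : tvsType R} (U : set E) :=
  forall (x y : E) (a b : R), U x -> U y -> `|a| + `|b| <= 1 -> U (a *: x + b *: y).

Definition strong_dual_barrelled (E : tvsType R) :=
  forall B : set (E -> R),
    B `<=` topdual E ->
    (forall f g (a b : R), B f -> B g -> `|a| + `|b| <= 1 ->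
        B (fun x => a * f x + b * g x)) ->
    (forall f, topdual E f -> exists2 r : R, 0 < r &
        forall t : R, r <= `|t| -> exists2 g, B g & f = (fun x => t * g x)) ->
    closed (set_val @^-1` B : set (strong_dual E)) ->
    forall z : strong_dual E, set_val z = (fun _ => 0) ->
      nbhs z (set_val @^-1` B : set (strong_dual E)).

Definition resolution {T : Type} (A : (nat -> nat) -> set T) (S : set T) :=
  (forall a b : nat -> nat, (forall n, (a n <= b n)%N) -> A a `<=` A b) /\
  \bigcup_(a in [set: nat -> nat]) A a = S.

Definition quasi_DF (E : tvsType R) :=
  (exists B : (nat -> nat) -> set E,
      [/\ resolution B setT, forall a, tvs_bounded (B a) &
          forall C : set E, tvs_bounded C -> exists a, C `<=` B a]) /\
  (exists A : (nat -> nat) -> set (E -> R),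
      resolution A (topdual E) /\
      forall (a : nat -> nat) (s : nat -> E -> R),
        (forall n, A a (s n)) -> equicontinuous [set: nat] s).

Definition separable_space (T : topologicalType) :=
  exists D : set T, countable D /\ dense D.

Definition tychonoff_space (T : topologicalType) :=
  hausdorff_space T /\ completely_regular_space T.

Definition cosmic (R' : realType) (T : topologicalType) :=
  tychonoff_space T /\
  exists (M : pseudoMetricType R') (f : M -> T),
    [/\ hausdorff_space M, separable_space M, continuous f & f @` setT = setT].

Definition aleph0_space (R' : realType) (T : topologicalType) :=
  tychonoff_space T /\
  exists (M : pseudoMetricType R') (f : M -> T),
    [/\ hausdorff_space M, separable_space M, continuous f, f @` setT = setT &
        forall K : set T, compact K -> exists2 C : set M, compact C & f @` C = K].

Definition tvs_metrizable (F : tvsType R) :=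
  exists U : nat -> set F,
    (forall n, nbhs 0 (U n)) /\ forall V, nbhs 0 V -> exists n, U n `<=` V.

Definition tvs_complete (F : tvsType R) :=
  forall G : set_system F, ProperFilter G ->
    (forall U, nbhs 0 U -> exists2 A, G A & forall x y, A x -> A y -> U (x - y)) ->
    exists x : F, G --> x.

Definition frechet (F : tvsType R) :=
  [/\ hausdorff_space F, tvs_metrizable F & tvs_complete F].

(** strict (LF)-space: E is the locally convex inductive limit of an increasing
    sequence (E_n, tau_n) of Frechet spaces with tau_{n+1}|E_n = tau_n.
    E_n is represented by a Frechet space F n with a linear injection j n into E;
    the inclusion E_n -> E_{n+1} is i n. *)
Definition strict_LF (E : tvsType R) :=
  exists (F : nat -> tvsType R) (j : forall n, F n -> E) (i : forall n, F n -> F n.+1),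
    [/\ forall n, frechet (F n),
        forall n, linear_map (j n) /\ injective (j n),
        forall n, (forall x : F n, j n.+1 (i n x) = j n x) /\
          (forall (x : F n) (U : set (F n)),
            nbhs x U <-> exists2 V, nbhs (i n x) V & (fun y => V (i n y)) `<=` U),
        \bigcup_(n in [set: nat]) range (j n) = setT &
        forall U : set E, absolutely_convex U ->
          (nbhs 0 U <-> forall n, nbhs 0 (fun y => U (j n y)))].

End lcs_defs.

(* Main.v *)
Require Import Defs.
From HB Require Import structures.
From mathcomp Require Import all_boot all_order all_algebra.
From mathcomp Require Import all_classical all_reals all_analysis.
From mathcomp Require Import ring lra.

(* Let [B] be the resolution by bounded sets and [d n] a dense sequence of the
   strong dual. Topologize the pairs [(x, a)] with [x] in [B a] by the functions
   [d n x] and the coordinates [a k]: this is a separable metric space. If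
   [(x_j, a_j)] converges to [(x, a)], then [x] and all [x_j] lie in a single
   bounded set [B c], where [c] is the pointwise supremum of [a] and the [a_j];
   on [B c] the [d n] approximate every continuous functional uniformly, so
   [x_j] converges weakly to [x]. Hence the first projection is continuous into
   [E_w]. A weakly compact set [K] is bounded by Mackey's theorem, hence
   contained in some [B a], and is the image of the compact set of all [(x, a)]
   with [x] in [K]. *)

Set Implicit Arguments.
Unset Strict Implicit.
Unset Printing Implicit Defensive.
Import Order.TTheory GRing.Theory Num.Theory.
Import numFieldTopology.Exports numFieldNormedType.Exports.
Local Open Scope classical_set_scope.
Local Open Scope ring_scope.

(** * The Hahn-Banach theorem *)

Section hahn_banach.
Context {R : realType} {V : lmodType R}.
Implicit Types (p q : V -> R) (x y : V).

Definition sublinear q :=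
  (forall x y, q (x + y) <= q x + q y) /\
  (forall c x, 0 < c -> q (c *: x) <= c * q x).

Lemma sublinear0 q : sublinear q -> q 0 = 0.
Proof.
move=> [_ qZ]; have := qZ 2 0; have := qZ 2^-1 0.
by rewrite !scaler0 invr_gt0 ltr0Sn => /(_ isT) + /(_ isT); lra.
Qed.

Lemma sublinearZ q c x : sublinear q -> 0 <= c -> q (c *: x) = c * q x.
Proof.
move=> sq; rewrite le_eqVlt => /predU1P[<-|c0].
  by rewrite scale0r mul0r sublinear0.
apply/eqP; rewrite eq_le sq.2//= -ler_pdivlMl//.
rewrite -{1}(scale1r x) -(mulVf (lt0r_neq0 c0)) -scalerA.
by apply: sq.2; rewrite invr_gt0.
Qed.

Lemma sublinearN q x : sublinear q -> - q (- x) <= q x.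
Proof. by move=> sq; have := sq.1 x (- x); rewrite subrr sublinear0//; lra. Qed.

(** Used three times: for [lower_along], for the infimum of a chain in Zorn's lemma, and for the
    gauge of a convex neighbourhood. *)
Lemma sublinear_inf (S : V -> set R) : (forall x, has_inf (S x)) ->
  (forall x y s t, S x s -> S y t -> exists2 u, S (x + y) u & u <= s + t) ->
  (forall c x s, 0 < c -> S x s -> exists2 u, S (c *: x) u & u <= c * s) ->
  sublinear (fun x => inf (S x)).
Proof.
move=> infS SD SZ.
have infle x u : S x u -> inf (S x) <= u by apply: ge_inf; case: (infS x).
split=> [x y|c x c0].
  rewrite -lerBlDr; apply: lb_le_inf => [|s xs]; first by case: (infS x).
  rewrite lerBlDr -lerBlDl; apply: lb_le_inf => [|t yt]; first by case: (infS y).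
  rewrite lerBlDl; have [u Su ust] := SD _ _ _ _ xs yt.
  exact: le_trans (infle _ _ Su) ust.
rewrite -ler_pdivrMl//; apply: lb_le_inf => [|s xs]; first by case: (infS x).
rewrite ler_pdivrMl//; have [u Su us] := SZ _ _ _ c0 xs.
exact: le_trans (infle _ _ Su) us.
Qed.

(* A sublinear [q] that equals all its [lower_along q y] is additive, so that
   linear functionals arise from Zorn's lemma as minimal sublinear functionals.
   [lower_along q y] is the largest sublinear functional below [q] that is at
   most [- q y] at [- y]. *)
Definition lower_along q y x :=
  inf [set q (x + t *: y) - t * q y | t in [set t : R | 0 <= t]].

Lemma has_inf_lower_along q y x : sublinear q ->
  has_inf [set q (x + t *: y) - t * q y | t in [set t : R | 0 <= t]].
Proof.
move=> sq; split; first by exists (q (x + 0 *: y) - 0 * q y), 0 => /=.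
exists (- q (- x)) => _ [t t0 <-]; rewrite -sublinearZ//.
have := sq.1 (x + t *: y) (- x); rewrite addrAC subrr add0r; lra.
Qed.

Lemma sublinear_lower_along q y : sublinear q -> sublinear (lower_along q y).
Proof.
move=> sq; apply: sublinear_inf => [x|x x' _ _ [s s0 <-] [t t0 <-]|c x _ c0 [t t0 <-]].
- exact: has_inf_lower_along.
- exists (q (x + x' + (s + t) *: y) - (s + t) * q y).
    by exists (s + t) => //=; rewrite addr_ge0.
  rewrite scalerDl addrACA; have := sq.1 (x + s *: y) (x' + t *: y); lra.
- exists (q (c *: x + (c * t) *: y) - (c * t) * q y).
    by exists (c * t) => //=; rewrite mulr_ge0// ltW.
  rewrite -scalerA -scalerDr; have := sq.2 c (x + t *: y) c0; lra.
Qed.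

Lemma lower_along_le q y x t : sublinear q -> 0 <= t ->
  lower_along q y x <= q (x + t *: y) - t * q y.
Proof.
move=> sq t0; apply: ge_inf; last by exists t.
by have [] := has_inf_lower_along y x sq.
Qed.

Lemma lower_along_le0 q y x : sublinear q -> lower_along q y x <= q x.
Proof.
move=> sq; have := lower_along_le y x sq (lexx 0).
by rewrite scale0r addr0 mul0r subr0.
Qed.

Lemma lower_along_le1 q y x : sublinear q ->
  lower_along q y x <= q (x + y) - q y.
Proof.
by move=> sq; have := lower_along_le y x sq ler01; rewrite scale1r mul1r.
Qed.

(** Minimality forces [lower_along q y = q], and [lower_along_le1] then supplies superadditivity. *)
Lemma minimal_sublinear_linear q : sublinear q ->
  (forall q', sublinear q' -> (forall x, q' x <= q x) -> q' = q) ->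
  forall a x y, q (a *: x + y) = a * q x + q y.
Proof.
move=> sq qmin.
have qD x y : q (x + y) = q x + q y.
  apply/eqP; rewrite eq_le sq.1/=.
  have := lower_along_le1 y x sq.
  rewrite (qmin (lower_along q y)); first by lra.
  - exact: sublinear_lower_along.
  - by move=> z; exact: lower_along_le0.
have qN x : q (- x) = - q x.
  by apply/eqP; rewrite -addr_eq0 -qD addNr sublinear0.
move=> a x y; rewrite qD; congr (_ + _).
have [a0|a0] := leP 0 a; first exact: sublinearZ.
by rewrite -[a]opprK scaleNr qN sublinearZ ?mulNr// oppr_ge0 ltW.
Qed.

(** Zorn's lemma for the reversed pointwise order. A nonempty chain is bounded by its pointwise
    infimum, which is finite because [- p (- x) <= q x] for every sublinear [q] below [p]. *)
Lemma minimal_sublinear_below p : sublinear p ->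
  exists q, [/\ sublinear q, forall x, q x <= p x &
    forall q', sublinear q' -> (forall x, q' x <= q x) -> q' = q].
Proof.
move=> sp.
pose T := {q : V -> R | sublinear q /\ forall x, q x <= p x}.
pose leT (q r : T) := `[< forall x, sval r x <= sval q x >].
have [|r s t /asboolP rs /asboolP st|||[q [sq qp]] qmax] := @Zorn T leT.
- by move=> t; exact/asboolP.
- by apply/asboolP => x; exact: le_trans (st x) (rs x).
- move=> [s ?] [t ?] /asboolP/= st /asboolP/= ts.
  apply: eq_exist; apply/funext => x.
  by apply/eqP; rewrite eq_le st ts.
- move=> A Atot.
  have [[q0 Aq0]|/set0P/negP/negPn/eqP->] := pselect (A !=set0); last first.
    by exists (exist _ p (conj sp (fun x => lexx (p x))) : T).
  pose S x := [set sval a x | a in A].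
  have infS x : has_inf (S x).
    split; first by exists (sval q0 x), q0.
    exists (- p (- x)) => _ [[a [sa ap]] _ <-]/=.
    by apply: le_trans (sublinearN x sa); rewrite lerN2.
  have sinf : sublinear (fun x => inf (S x)).
    apply: sublinear_inf => // [x y _ _ [a Aa <-] [b Ab <-]|c x _ c0 [a Aa <-]].
      have [/asboolP ab|/asboolP ba] := Atot _ _ Aa Ab.
        exists (sval b (x + y)); first by exists b.
        by case: (svalP b) => -[sb _] _; have := sb x y; have := ab x; lra.
      exists (sval a (x + y)); first by exists a.
      by case: (svalP a) => -[sa _] _; have := sa x y; have := ba y; lra.
    exists (sval a (c *: x)); first by exists a.
    by case: (svalP a) => -[_ sa] _; exact: sa.
  have infle a x : A a -> inf (S x) <= sval a x.
    by move=> Aa; apply: ge_inf; [case: (infS x)|exists a].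
  have infp x : inf (S x) <= p x.
    by apply: le_trans (infle _ x Aq0) _; case: (svalP q0).
  exists (exist _ (fun x => inf (S x)) (conj sinf infp) : T) => a Aa; apply/asboolP => x /=.
  exact: infle.
- exists q; split => // q' sq' q'q.
  have q'p x : q' x <= p x by exact: le_trans (q'q x) (qp x).
  have := qmax (exist _ q' (conj sq' q'p) : T); rewrite /leT/= => /(_ _)/(congr1 sval)/=.
  by apply; exact/asboolP.
Qed.

(** Minimizing below [lower_along p x0] rather than [p] forces [f (- x0) <= - p x0], which for
    linear [f] means [p x0 <= f x0]. *)
Lemma hahn_banach p x0 : sublinear p ->
  exists f : V -> R, [/\ forall a x y, f (a *: x + y) = a * f x + f y,
    forall x, f x <= p x & f x0 = p x0].
Proof.
move=> sp.
have [f [sf fp fmin]] := minimal_sublinear_below (sublinear_lower_along x0 sp).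
have flin := minimal_sublinear_linear sf fmin.
have fp' x : f x <= p x by exact: le_trans (fp x) (lower_along_le0 _ _ sp).
exists f; split => //; apply/eqP; rewrite eq_le fp'/=.
have fN : f (- x0) = - f x0.
  by have := flin (-1) x0 0; rewrite addr0 scaleN1r (sublinear0 sf); lra.
have := le_trans (fp (- x0)) (lower_along_le1 _ _ sp).
by rewrite addNr (sublinear0 sp) fN; lra.
Qed.

End hahn_banach.

(** * Seminorms and Mackey's theorem *)

Definition symmetric_fun {R : realType} {V : lmodType R} (p : V -> R) :=
  forall x, p (- x) = p x.

Section seminorm.
Context {R : realType} {V : lmodType R}.
Implicit Types (p : V -> R).

Lemma seminormZ p c x : sublinear p -> symmetric_fun p ->
  p (c *: x) = `|c| * p x.
Proof.
move=> sp symp; have [c0|c0] := leP 0 c; first by rewrite sublinearZ// ger0_norm.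
by rewrite -symp -scaleNr sublinearZ ?ltr0_norm// oppr_ge0 ltW.
Qed.

Lemma seminorm_ge0 p x : sublinear p -> symmetric_fun p -> 0 <= p x.
Proof. by move=> sp symp; have := sublinearN x sp; rewrite symp; lra. Qed.

Lemma seminorm_dominates p (f : V -> R) x : symmetric_fun p ->
  (forall a x y, f (a *: x + y) = a * f x + f y) -> (forall x, f x <= p x) ->
  `|f x| <= p x.
Proof.
move=> symp flin fp; rewrite ler_norml fp andbT lerNl.
have f0 : f 0 = 0 by have := flin 1 0 0; rewrite scaler0 addr0; lra.
have -> : - f x = f (- x).
  by have := flin (-1) x 0; rewrite scaleN1r addr0 f0; lra.
by rewrite -symp.
Qed.

(* Gliding hump: perturbing by [3 ^- n.+1] times a functional norming [x n],
   with a sign that avoids cancellation, makes the limit large at every [x n],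
   since all later perturbations together amount to half of that one. *)
Lemma seminorm_uniform_bounded p (K : set V) : sublinear p -> symmetric_fun p ->
  (forall f : V -> R, (forall a x y, f (a *: x + y) = a * f x + f y) ->
    (forall x, f x <= p x) -> exists C, forall x, K x -> f x <= C) ->
  exists C, forall x, K x -> p x <= C.
Proof.
move=> sp symp Kbnd; apply/not_existsP => Kunb.
have p0 z : 0 <= p z by exact: seminorm_ge0.
have {}Kunb C : exists x, K x /\ C < p x.
  apply/not_existsP => h; apply: (Kunb C) => x Kx.
  by rewrite leNgt; apply/negP => Cp; apply: (h x).
(* The coefficient [2 * r n.+1] of stage [n] equals [r n - r n.+1], so the perturbations from stage
   [n] on telescope to [r n]. *)
pose r n : R := 3 ^- n / 2.
have r0 n : 0 < r n by rewrite divr_gt0// invr_gt0 exprn_gt0.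
have rS n : r n = 3 * r n.+1.
  by rewrite /r exprS invfM; field; rewrite expf_neq0.
have /choice[x xK] n := Kunb (n%:R / r n.+1).
have /choice[g gP] n := hahn_banach (x n) sp.
pose f := fix f n z := if n is m.+1 then
  f m z + (if 0 <= f m (x m) then 1 else -1) * (2 * r n) * g m z else 0.
have fS n z : f n.+1 z =
  f n z + (if 0 <= f n (x n) then 1 else -1) * (2 * r n.+1) * g n z by [].
have flin n a y z : f n (a *: y + z) = a * f n y + f n z.
  elim: n => [|n IH]; first by rewrite /= mulr0 addr0.
  by have [glin _ _] := gP n; rewrite !fS IH glin; ring.
have glep n z : `|g n z| <= p z by have [? ? _] := gP n; exact: seminorm_dominates.
have fbnd n m z : `|f (n + m)%N z - f n z| <= (r n - r (n + m)%N) * p z.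
  elim: m => [|m IH]; first by rewrite addn0 !subrr normr0 mul0r.
  rewrite addnS fS; set s := if _ then _ else _.
  have s1 : `|s| = 1 by rewrite /s; case: ifP; rewrite ?normrN normr1.
  have := IH; have := rS (n + m)%N; have := r0 (n + m).+1.
  set u := f _ z; set v := f n z; set r1 := r (n + m)%N; set r2 := r _.+1.
  move=> r20 r12 uv.
  have : `|s * (2 * r2) * g (n + m)%N z| <= 2 * r2 * p z.
    have r20' : 0 < 2 * r2 by rewrite mulr_gt0.
    rewrite normrM [`|s * _|]normrM s1 mul1r (gtr0_norm r20').
    by apply: ler_wpM2l (glep _ _); exact: ltW.
  have := ler_normD (u - v) (s * (2 * r2) * g (n + m)%N z).
  rewrite addrAC r12 in uv *; nra.
have r_cvg : r n @[n --> \oo] --> (0 : R).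
  rewrite -[0](mul0r 2^-1); apply: cvgMl.
  under eq_fun do rewrite -exprVn.
  by apply: cvg_expr; rewrite ger0_norm//; lra.
have f_cvg z : cvgn (f ^~ z).
  (* By [fbnd], subtracting [r n * p z] makes the sequence nondecreasing. *)
  have -> : f ^~ z = (fun n => f n z - r n * p z) \+ (fun n => r n * p z).
    by apply/funext => n /=; rewrite subrK.
  apply: is_cvgD; last by apply: is_cvgMl; exact: cvgP r_cvg.
  apply: nondecreasing_is_cvgn.
    apply/nondecreasing_seqP => n.
    by have := fbnd n 1%N z; rewrite addn1 ler_norml => /andP[]; lra.
  exists (r 0%N * p z) => _ [n _ <-].
  have := fbnd 0%N n z; rewrite add0n subr0 => /ler_normlW.
  by have := mulr_ge0 (ltW (r0 n)) (p0 z); lra.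
pose F z := limn (f ^~ z).
have Flin a y z : F (a *: y + z) = a * F y + F z.
  apply/cvg_lim => //; under eq_fun do rewrite flin.
  by apply: cvgD; [apply: cvgMr|]; exact: f_cvg.
have Fbnd n z : `|F z - f n z| <= r n * p z.
  have fF : `|f m z - f n z| @[m --> \oo] --> `|F z - f n z|.
    by apply: cvg_norm; apply: cvgB; [exact: f_cvg|exact: cvg_cst].
  rewrite -(cvg_lim _ fF)//; apply: limr_le; first exact: cvgP fF.
  exists n => // m /= nm; rewrite -(subnKC nm).
  apply: le_trans (fbnd _ _ _) _; apply: ler_wpM2r => //.
  by rewrite gerBl ltW.
(* As [f 0] vanishes and [r 0 = 1 / 2], the limit is dominated by [p], so the hypothesis applies to
   [F] and to [- F]. *)
have Fp z : `|F z| <= p z.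
  have := Fbnd 0%N z; rewrite subr0 /r expr0 invr1.
  by have := p0 z; lra.
have FN a y z : - F (a *: y + z) = a * - F y + - F z by rewrite Flin; ring.
have [C1 FC1] := Kbnd F Flin (fun z => ler_normlW (Fp z)).
have [|C2 FC2] := Kbnd (fun z => - F z) FN.
  by move=> z; apply: le_trans (Fp z); rewrite -normrN ler_norm.
have [n nC] : exists n : nat, `|C1| + `|C2| < n%:R :> R.
  exists (Num.truncn (`|C1| + `|C2|)).+1.
  by rewrite truncnS_gt.
have [Kx px] := xK n.
have FxC : `|F (x n)| <= `|C1| + `|C2|.
  have := FC1 _ Kx; have := FC2 _ Kx.
  have := ler_norm C1; have := ler_norm C2.
  have := normr_ge0 C1; have := normr_ge0 C2.
  by rewrite ler_norml => *; apply/andP; split; lra.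
have [_ _ gx] := gP n.
(* [F] differs from [f n.+1] at [x n] by at most half of this lower bound, which leaves at least
   [r n.+1 * p (x n) > n]. *)
have fx : 2 * r n.+1 * p (x n) <= `|f n.+1 (x n)|.
  have := mulr_ge0 (ltW (r0 n.+1)) (p0 (x n)).
  rewrite fS gx; have [f0|f0] := leP 0 (f n (x n)) => rp.
    by rewrite ger0_norm; lra.
  by rewrite ltr0_norm; lra.
have := Fbnd n.+1 (x n); have := lerB_dist (f n.+1 (x n)) (F (x n)).
rewrite [`|f n.+1 (x n) - _|]distrC.
by move: px; rewrite ltr_pdivrMr// mulrC; lra.
Qed.

End seminorm.

(** The seminorm is the Minkowski gauge of [W], the intersection of a convex neighbourhood [b]
    inside [U] with its reflection. *)
Lemma locally_convex_seminorm (R : realType) (E : tvsType R) (U : set E) :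
  nbhs 0 U -> exists p : E -> R, [/\ sublinear p, symmetric_fun p,
    nbhs 0 [set x | p x <= 1] & [set x | p x < 1] `<=` U].
Proof.
move=> U0.
have [B Bconv [Bopen Bbasis]] := @locally_convex R E.
have [b [/= Bb b0] bU] := Bbasis 0 U U0.
have bnbhs : nbhs 0 b by apply: open_nbhs_nbhs; split => //; exact: Bopen.
pose W := b `&` (-%R @^-1` b).
have Wnbhs : nbhs 0 W.
  apply: filterI => //; apply: (@opp_continuous E 0).
  by rewrite oppr0.
have Wconv x y (s t : R) : 0 < s -> 0 < t -> s + t = 1 -> W x -> W y ->
    W (s *: x + t *: y).
  move=> s0 t0 st1; have s01 : 0 <= s <= 1 by lra.
  pose l := Itv01 (ltW s0) (andP s01).2.
  have b_conv u v : b u -> b v -> b (s *: u + t *: v).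
    move=> bu bv; have := Bconv b (mem_set Bb) u v l (mem_set bu) (mem_set bv).
    have -> : t = 1 - l%:num by rewrite /=; lra.
    by move=> /set_mem.
  move=> [bx bNx] [b_y bNy]; split; first exact: b_conv.
  by rewrite /= opprD -!scalerN; exact: b_conv.
have W0 : W 0 by exact: nbhs_singleton.
pose S x := [set t : R | 0 < t /\ W (t^-1 *: x)].
have absorb x : S x !=set0.
  have : (fun t : R^o => t *: x) t @[t --> 0] --> (0 : E).
    rewrite -(scale0r x).
    exact: (cvg_comp2 cvg_id (cvg_cst x) (@scale_continuous R E (0, x))).
  move=> /(_ W Wnbhs)/nbhs_ballP[e /= e0 eW].
  (* The inverse [e / 2] lies in the ball of radius [e] around 0. *)
  exists (2 / e); split; first by rewrite divr_gt0.
  apply: eW; rewrite /ball/= sub0r normrN invf_div ger0_norm; last by lra.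
  by lra.
have infS x : has_inf (S x).
  by split => //; exists 0 => t [/ltW].
have WN x : W x -> W (- x) by move=> [bx bNx]; split => //=; rewrite opprK.
exists (fun x => inf (S x)); split.
- apply: sublinear_inf => // [x y s t [s0 Ws] [t0 Wt]|c x s c0 [s0 Ws]].
    exists (s + t) => //; split; first exact: addr_gt0.
    have st0 : s + t != 0 by rewrite lt0r_neq0// addr_gt0.
    have -> : (s + t)^-1 *: (x + y) =
        (s / (s + t)) *: (s^-1 *: x) + (t / (s + t)) *: (t^-1 *: y).
      rewrite !scalerA scalerDr; congr (_ *: _ + _ *: _); field;
      by rewrite st0 lt0r_neq0.
    by apply: Wconv => //; rewrite ?divr_gt0 ?addr_gt0// -mulrDl divff.
  exists (c * s) => //; split; first exact: mulr_gt0.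
  rewrite scalerA invfM mulrAC mulVf ?mul1r ?lt0r_neq0//.
- move=> x; congr inf; apply/seteqP.
  by split=> t [t0 /WN]; rewrite -scalerN ?opprK.
- apply: filterS Wnbhs => x Wx; apply: ge_inf; first by case: (infS x).
  by split => //; rewrite invr1 scale1r.
- move=> x /= px1; have [s [s0 Ws] s1] := inf_lt (absorb x) px1.
  suff [/bU] : W x by [].
  (* With [s < 1], the point [x] is a convex combination of [s^-1 *: x] and 0, both in [W]. *)
  have -> : x = s *: (s^-1 *: x) + (1 - s) *: 0.
    by rewrite scaler0 addr0 scalerA divff ?scale1r// lt0r_neq0.
  by apply: Wconv => //; lra.
Qed.

Section dual.
Context {R : realType} {E : tvsType R}.

(** Linearity gives [|f x - f y| <= p (y - x)], and scaling [y - x] by [(e / 2)^-1] turns the bound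
    1 near 0 into [e / 2]. *)
Lemma dominated_topdual (p f : E -> R) : symmetric_fun p ->
  sublinear p -> nbhs 0 [set x | p x <= 1] ->
  (forall a x y, f (a *: x + y) = a * f x + f y) -> (forall x, f x <= p x) ->
  topdual E f.
Proof.
move=> symp sp p1 flin fp; split => // x.
apply/cvgrPdist_lt => e e0.
have e20 : 0 < e / 2 by rewrite divr_gt0.
have : ((e / 2)^-1 *: (y - x)) @[y --> x] --> (0 : E).
  have : (y - x) @[y --> x] --> x - x.
    exact: (@cvg_comp2 E E E E _ _ _ _ _ _ _ id (cst x) (fun a b : E => a - b)
      cvg_id (cvg_cst x) (@sub_continuous E (x, x))).
  rewrite subrr => yx0; rewrite -[X in _ --> X](scaler0 _ (e / 2)^-1).
  exact: (@cvg_comp2 E R^o E E _ _ _ _ _ _ _ (cst (e / 2)^-1) (fun y => y - x)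
    (fun a b => a *: b) (cvg_cst _) yx0 (@scale_continuous R E (_, 0))).
move=> /(_ _ p1) xp1; apply: (@filterS _ (nbhs x) _ _ _ _ xp1) => y /=.
rewrite seminormZ// gtr0_norm ?invr_gt0// ler_pdivrMl// mulr1 => pyx.
have <- : f (x - y) = f x - f y by have := flin (-1) y x; rewrite scaleN1r addrC; lra.
apply: (@le_lt_trans _ _ (e / 2)); last by lra.
by apply: le_trans pyx; rewrite -(opprB x y) symp; exact: seminorm_dominates.
Qed.

(** Some neighbourhood of 0 misses [x - y], so its seminorm does not vanish there; Hahn-Banach gives
    a functional attaining the seminorm at [x - y]. *)
Lemma topdual_separates (x y : E) : hausdorff_space E -> x != y ->
  exists2 f, topdual E f & f x != f y.
Proof.
move=> hE xy.
have [U [U0 Uxy]] : exists U, nbhs 0 U /\ ~ U (x - y).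
  apply: contrapT => /forallNP h; move/eqP: xy; apply.
  apply/eqP; rewrite -subr_eq0 eq_sym; apply/eqP/hE => A B A0 Bxy.
  exists (x - y); split; last exact: nbhs_singleton.
  by have := h A; rewrite not_andE => -[//|/contrapT].
have [p [sp symp p1 pU]] := locally_convex_seminorm U0.
have [f [flin fp fxy]] := hahn_banach (x - y) sp.
exists f; first exact: dominated_topdual fp.
apply/eqP => fE; apply: Uxy; apply: pU; rewrite /= -fxy.
have -> : f (x - y) = 0 by have := flin (-1) y x; rewrite scaleN1r addrC; lra.
exact: ltr01.
Qed.

(** Functionals dominated by the seminorm of [U] are continuous, so the gliding hump bounds that
    seminorm on [K]. *)
Lemma mackey_bounded (K : set E) :
  (forall f, topdual E f -> exists C, forall x, K x -> f x <= C) -> tvs_bounded K.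
Proof.
move=> Kbnd U /locally_convex_seminorm[p [sp symp p1 pU]].
have [|C pC] := @seminorm_uniform_bounded _ _ p K sp symp.
  by move=> f flin fp; apply: Kbnd; exact: dominated_topdual fp.
exists (`|C| + 1); first by rewrite ltr_wpDl.
move=> t Ct x Kx; have t0 : 0 < `|t| by apply: lt_le_trans Ct; rewrite ltr_wpDl.
exists (t^-1 *: x); last by rewrite scalerA divff ?scale1r// -normr_gt0.
apply: pU; rewrite /= seminormZ// normfV ltr_pdivrMl// mulr1.
by have := pC _ Kx; have := ler_norm C; lra.
Qed.

End dual.

(** * Topologies induced by sequences of functions *)

(* [T] with the topology induced by a sequence [g] of real functions; the ball
   corresponds to the distance [sup_n min(|g n x - g n y|, 1/(n+1))]. *)
Definition seq_initial {R : realType} {T : choiceType} (g : nat -> T -> R) : Type := T.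

Section seq_initial.
Context {R : realType} {T : choiceType} (g : nat -> T -> R).
Local Notation M := (seq_initial g).

Definition seq_ball (x : M) (e : R) (y : M) :=
  forall n, `|g n x - g n y| < e \/ n.+1%:R^-1 < e.

Let seq_ent : set_system (M * M) := entourage_ seq_ball.

Let seq_ball_center x (e : R) : 0 < e -> seq_ball x e x.
Proof. by move=> e0 n; left; rewrite subrr normr0. Qed.

Let seq_ball_sym x y (e : R) : seq_ball x e y -> seq_ball y e x.
Proof. by move=> h n; have := h n; rewrite distrC. Qed.

Let seq_ball_triangle x y z (e1 e2 : R) :
  seq_ball x e1 y -> seq_ball y e2 z -> seq_ball x (e1 + e2) z.
Proof.
move=> xy yz n.
have n0 : 0 < n.+1%:R^-1 :> R by rewrite invr_gt0.
have xz : `|g n x - g n z| <= `|g n x - g n y| + `|g n y - g n z|.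
  exact: ler_distD.
have xy0 := normr_ge0 (g n x - g n y); have yz0 := normr_ge0 (g n y - g n z).
move: (xy n) (yz n) xz xy0 yz0 n0.
move: `|g n x - g n y| `|g n y - g n z| `|g n x - g n z| n.+1%:R^-1 => a b c d.
by case=> ?; case=> ? ? ? ? ?; [left|right|right|right]; lra.
Qed.

HB.instance Definition _ := Choice.on M.
HB.instance Definition _ := hasNbhs.Build M (nbhs_ seq_ent).
HB.instance Definition _ := Nbhs_isPseudoMetric.Build R M
  (erefl : nbhs = nbhs_ seq_ent) seq_ball_center seq_ball_sym seq_ball_triangle
  (erefl : seq_ent = entourage_ seq_ball).

Lemma seq_ballE (x : M) (e : R) : ball x e = seq_ball x e.
Proof. by []. Qed.

Lemma seq_initial_hausdorff :
  (forall x y : T, (forall n, g n x = g n y) -> x = y) -> hausdorff_space M.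
Proof.
move=> ginj x y xy; apply: ginj => n; apply/eqP/negPn/negP => gxy.
(* The second term rules out the alternative [n.+1%:R^-1 < d] of [seq_ball]; the first contradicts
   the triangle inequality. *)
pose d := Num.min (`|g n x - g n y| / 2) n.+1%:R^-1.
have d0 : 0 < d by rewrite lt_min divr_gt0 ?normr_gt0 ?subr_eq0//= invr_gt0.
have [z [/(_ n) xz /(_ n) yz]] := xy _ _ (nbhsx_ballx x d d0) (nbhsx_ballx y d d0).
have dn : d <= n.+1%:R^-1 by rewrite ge_min lexx orbT.
have dg : d <= `|g n x - g n y| / 2 by rewrite ge_min lexx.
have : `|g n x - g n y| <= `|g n x - g n z| + `|g n y - g n z|.
  by rewrite [`|g n y - _|]distrC; exact: ler_distD.
move: xz yz dn dg d0.
move: `|g n x - g n y| `|g n x - g n z| `|g n y - g n z| n.+1%:R^-1 d => a b c u v.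
by case=> ?; case=> ? ? ? ? ?; lra.
Qed.

Lemma seq_initial_coord_continuous n : continuous (g n : M -> R).
Proof.
move=> x; apply/(cvgrPdist_lt (FF := nbhs_filter (x : M))) => e e0.
have d0 : 0 < Num.min e n.+1%:R^-1 by rewrite lt_min e0 invr_gt0/=.
apply: (@filterS M _ (nbhs_filter x) _ _ _ (nbhsx_ballx x _ d0)) => y /(_ n).
by rewrite !lt_min ltxx andbF => -[/andP[]|].
Qed.

(** A ball of radius [e] constrains only the finitely many coordinates with [n.+1%:R^-1 >= e]. *)
Lemma cvg_seq_initial {S : Type} (F : set_system S) {FF : Filter F} (f : S -> M) (y : M) :
  (forall n, g n (f x) @[x --> F] --> g n y) -> f x @[x --> F] --> y.
Proof.
move=> fy; apply/cvg_ballP => e e0.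
have finlt k : \forall x \near F, forall n, (n < k)%N -> `|g n y - g n (f x)| < e.
  elim: k => [|k IH]; first exact: nearW.
  have /cvgrPdist_lt/(_ e e0) fk := fy k.
  apply: filterS2 IH fk => x xk xe n.
  by rewrite ltnS leq_eqVlt => /predU1P[->//|]; exact: xk.
have := finlt (Num.truncn e^-1); apply: filterS => x xk; rewrite seq_ballE => n.
have [/xk|kn] := ltnP n (Num.truncn e^-1); [by left|right].
by rewrite invf_plt ?posrE// (lt_le_trans (truncnS_gt _))// ler_nat ltnS.
Qed.

(** The first [k] coordinates are cut into cells of width [1 / k], and one point is chosen from each
    nonempty cell. Points of one cell differ there by less than [1 / k]. *)
Lemma seq_initial_separable : separable_space M.
Proof.
have [[x0 _]|M0] := pselect (exists x : M, True); last first.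
  exists set0; split; first exact: countable0.
  by move=> U [x _]; exfalso; apply: M0; exists x.
pose code (k : nat) (x : M) := [seq Num.floor (k%:R * g n x) | n <- iota 0 k].
pose pt (kc : nat * seq int) := xget x0 [set x | code kc.1 x = kc.2].
exists (range pt); split.
  exact: card_le_trans (card_image_le _ _) (countableP _).
move=> U [x Ux] oU.
have /nbhs_ballP[e /= e0 xeU] : nbhs x U by exact: open_nbhs_nbhs.
pose k := (Num.truncn e^-1).+1.
have ek : e^-1 < k%:R by exact: truncnS_gt.
have k0 : 0 < k%:R :> R by rewrite ltr0n.
have kinv : k%:R^-1 < e by rewrite invf_plt ?posrE.
exists (pt (k, code k x)); split; last by exists (k, code k x).
have /= := @xgetI _ x0 [set y | code k y = code k x] x erefl.
rewrite -/(pt (k, code k x)); move: (pt _) => y /eq_in_map yx.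
apply: xeU; rewrite seq_ballE => n; have [nk|kn] := ltnP n k; [left|right]; last first.
  apply: le_lt_trans kinv; rewrite lef_pV2 ?posrE// ler_nat.
  exact: leq_trans kn _.
have /yx fl : n \in iota 0 k by rewrite mem_iota.
have := floor_le (k%:R * g n x); have := floorD1_gt (k%:R * g n x).
have := floor_le (k%:R * g n y); have := floorD1_gt (k%:R * g n y).
rewrite fl intrD; set a := (Num.floor _)%:~R => h1 h2 h3 h4.
have : `|k%:R * (g n x - g n y)| < 1 by rewrite mulrBr ltr_norml; apply/andP; split; lra.
rewrite normrM gtr0_norm// -ltr_pdivlMl// mulr1 => /lt_trans; exact.
Qed.

End seq_initial.

(** * The weak space *)

Section weak_space.
Context {R : realType} {E : tvsType R}.

Lemma cvg_weak_spaceP (F : set_system E) (x : E) : Filter F ->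
  (F --> (x : weak_space E)) <->
  (forall f, topdual E f -> f y @[y --> F] --> f x).
Proof.
move=> FF.
pose ev (y : E) (f : set_type (topdual E)) : R := set_val f y.
split=> [Fx f Ef|Ff].
  have : {ptws, ev @ F --> ev x}.
    exact: cvg_comp Fx (@initial_continuous E _ (ev : E -> {ptws _ -> R}) x).
  by move/(@pointwise_cvgP (strong_dual E) R)/(_ (SigSub (mem_set Ef))).
have evF : {ptws, ev @ F --> ev x}.
  apply/(@pointwise_cvgP (strong_dual E) R) => -[f fE].
  by apply: Ff; exact: set_mem.
move=> U [_ [[W oW <-] Wx WU]]; apply: filterS WU _.
by apply: evF; exact: open_nbhs_nbhs.
Qed.

Lemma topdual_weak_continuous (f : E -> R) : topdual E f ->
  continuous (f : weak_space E -> R).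
Proof.
move=> Ef x.
have /cvg_weak_spaceP : nbhs (x : weak_space E) --> (x : weak_space E) by [].
exact.
Qed.

Lemma weak_space_tychonoff : hausdorff_space E -> tychonoff_space (weak_space E).
Proof.
move=> hE; split; last exact: uniform_completely_regular.
move=> x y xy; apply/eqP/negPn/negP => nxy.
have [f Ef] := topdual_separates hE nxy.
apply/negP; rewrite negbK; apply/eqP/(@Rhausdorff R) => A B Afx Bfy.
have [z [Az Bz]] := xy _ _ (topdual_weak_continuous Ef Afx)
  (topdual_weak_continuous Ef Bfy).
by exists (f z).
Qed.

Lemma weakly_compact_bounded (K : set (weak_space E)) : compact K ->
  tvs_bounded (K : set E).
Proof.
move=> cK; apply: mackey_bounded => f Ef.
have /compact_bounded[M [_ MfK]] : compact (f @` K).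
  apply: continuous_compact cK; apply: continuous_subspaceT.
  exact: topdual_weak_continuous.
exists (M + 1) => x Kx; apply: le_trans (ler_norm _) _.
by apply: (MfK (M + 1)); [rewrite ltrDl|exists x].
Qed.

(** Uniform closeness on a bounded set defines a strong neighbourhood, which a dense set must
    meet. *)
Lemma topdual_dense_sequence : separable_space (strong_dual E) ->
  exists d : nat -> E -> R, (forall n, topdual E (d n)) /\
    forall f B (e : R), topdual E f -> tvs_bounded B -> 0 < e ->
      exists n, forall x, B x -> `|f x - d n x| < e.
Proof.
move=> [D [cD dD]].
have [s sD] : exists s : nat -> strong_dual E, D `<=` range s.
  have /pfcard_geP[D0|[s]] := cD; last first.
    by exists s; exact: surj.
  (* If [D] is empty, the constant sequence at the zero functional serves. *)
  have z : strong_dual E.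
    apply: (SigSub (x := fun=> 0)); apply/mem_set; split=> [a x y|].
      by rewrite mulr0 addr0.
    exact: cst_continuous.
  by exists (fun=> z); rewrite D0.
exists (fun n => set_val (s n)); split=> [n|f B e Ef bB e0]; first exact: set_valP.
pose z : strong_dual E := SigSub (mem_set Ef).
pose O := [set g : strong_dual E | forall x, B x -> `|f x - set_val g x| < e].
have zO : nbhs z O.
  have ent_e : entourage [set xy : R * R | `|xy.1 - xy.2| < e].
    by rewrite -entourage_ballE; exists e.
  exact: (@initial_continuous (strong_dual E) _ set_val z _
    (@fam_nbhs E R (@tvs_bounded R E) B _ f ent_e bB)).
have [g [/interior_subset Og Dg]] : O^° `&` D !=set0.
  by apply: dD; [exists z|exact: open_interior].
by have [n _ sn] := sD _ Dg; exists n => x Bx; rewrite sn; exact: Og.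
Qed.

End weak_space.

(** * The separable metric space of pairs and its projection onto the weak space *)

Section bounded_resolution.
Context {R : realType} {E : tvsType R}.
Variables (B : (nat -> nat) -> set E) (d : nat -> E -> R).
Hypothesis B_mono : forall a b : nat -> nat, (forall n, (a n <= b n)%N) -> B a `<=` B b.
Hypothesis B_bounded : forall a, tvs_bounded (B a).
Hypothesis d_topdual : forall n, topdual E (d n).
Hypothesis d_dense : forall f A (e : R), topdual E f -> tvs_bounded A -> 0 < e ->
  exists n, forall x, A x -> `|f x - d n x| < e.

Let graph := {xa : E * (nat -> nat) | `[< B xa.2 xa.1 >]}.

Let coord n (m : graph) : R :=
  if odd n then ((val m).2 n./2)%:R else d n./2 (val m).1.

Let coord_odd k m : coord k.*2.+1 m = ((val m).2 k)%:R.
Proof. by rewrite /coord /= odd_double uphalf_double. Qed.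

Let coord_even k m : coord k.*2 m = d k (val m).1.
Proof. by rewrite /coord odd_double doubleK. Qed.

Let M := seq_initial coord.

Let point (m : M) : weak_space E := (val (m : graph)).1.

(** The odd coordinates determine [a]. Then [x] and [y] lie in the same bounded set [B a], where
    some [d n] is close enough to a separating functional to separate them too. *)
Let graph_hausdorff : hausdorff_space E -> hausdorff_space M.
Proof.
move=> hE; apply: seq_initial_hausdorff => -[[x a] /= xa] [[y b] /= yb] xy.
have ab : a = b.
  apply/funext => k; apply/eqP; rewrite -(eqr_nat R); apply/eqP.
  by have := xy k.*2.+1; rewrite !coord_odd.
subst b; have [xy0|nxy] := eqVneq x y; last exfalso.
  by subst y; congr exist; exact: bool_irrelevance.
have [f Ef fxy] := topdual_separates hE nxy.
have e0 : 0 < `|f x - f y| / 2 by rewrite divr_gt0 ?normr_gt0 ?subr_eq0.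
have [n fd] := d_dense Ef (B_bounded a) e0.
have dxy : d n x = d n y by have := xy n.*2; rewrite !coord_even.
have := fd x (asboolW xa); have := fd y (asboolW yb); rewrite dxy.
have := ler_distD (d n y) (f x) (f y); rewrite [`|d n y - _|]distrC.
lra.
Qed.

(* A sequence converging in [M] has second components bounded by a single [c],
   so its first components lie in the bounded set [B c], on which the [d n]
   uniformly approximate every continuous functional. *)
Let point_continuous : continuous point.
Proof.
move=> m; have mF := nbhs_filter (m : M).
apply/(cvg_weak_spaceP (point m) _) => f Ef; apply/cvgrPdist_lt => e e0.
(* If continuity fails at [m], each ball of radius [1 / (j + 1)] contains a bad point; these points
   form a sequence converging to [m]. *)
apply: contrapT => nbhsN.
have far j : exists m', ball m j.+1%:R^-1 m' /\ e <= `|f (point m) - f (point m')|.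
  apply: contrapT => /forallNP h; apply: nbhsN.
  have j0 : 0 < j.+1%:R^-1 :> R by rewrite invr_gt0.
  apply: (@filterS _ (nbhs m) _ _ _ _ (nbhsx_ballx m _ j0)) => m' mm' /=.
  by rewrite ltNge; apply/negP => em'; apply: (h m').
have /choice[s sP] := far.
have sm : s j @[j --> \oo] --> m.
  apply/cvg_ballP => r r0; near=> j.
  apply: (@le_ball _ _ _ j.+1%:R^-1); last by case: (sP j).
  by apply: ltW; near: j; exact: near_infty_natSinv_lt (PosNum r0).
have coord_cvg n : coord n (s j) @[j --> \oo] --> coord n m.
  exact: cvg_comp sm (@seq_initial_coord_continuous R _ coord n m).
have eventually_eq k : exists N, forall j, (N <= j)%N ->
    (val (s j : graph)).2 k = (val (m : graph)).2 k.
  have /cvgrPdist_lt/(_ 1 ltr01)[N _ sN] := coord_cvg k.*2.+1.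
  exists N => j /sN/=; rewrite !coord_odd ltr_norml => /andP[? ?].
  apply/eqP; rewrite eqn_leq; apply/andP.
  by split; rewrite -ltnS -(ltr_nat R) -natr1; lra.
have /choice[N NP] := eventually_eq.
(* From index [N k] on, the [k]-th entries agree with that of [m], so a finite sum dominates them
   all. *)
pose c k := ((val (m : graph)).2 k + \sum_(j < N k) (val (s j : graph)).2 k)%N.
have mc : B c (point m).
  by apply: B_mono (asboolW (valP (m : graph))) => k; exact: leq_addr.
have sc j : B c (point (s j)).
  apply: B_mono (asboolW (valP (s j : graph))) => k; rewrite /c.
  have [jN|Nj] := ltnP j (N k); last by rewrite (NP k j Nj) leq_addr.
  apply: leq_trans (leq_addl _ _).
  by rewrite (bigD1 (Ordinal jN))//= leq_addr.
(* One third each for approximating [f] by [d n] at the two points and for the variation of [d n]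
   between them. *)
have e30 : 0 < e / 3 by rewrite divr_gt0.
have [n fd] := d_dense Ef (B_bounded c) e30.
have /cvgrPdist_lt/(_ _ e30)[J _ dJ] := coord_cvg n.*2.
have := dJ J (leqnn J); rewrite /= !coord_even -/(point m) -/(point (s J)).
have := fd _ mc; have := fd _ (sc J); have := (sP J).2.
rewrite ler_normr !ltr_norml => /orP[]? /andP[? ?] /andP[? ?] /andP[? ?]; lra.
Unshelve. all: by end_near. Qed.

(** For fixed [a], the section sending [x] to [(x, a)] is continuous on [K]: its coordinates are
    constants or weakly continuous functionals. *)
Let point_compact_covering (K : set (weak_space E)) :
  (exists a, (K : set E) `<=` B a) -> compact K ->
  exists2 C : set M, compact C & point @` C = K.
Proof.
move=> [a Ka] cK.
have [->|/set0P[x0 Kx0]] := eqVneq K set0.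
  by exists set0; [exact: compact0|rewrite image_set0].
have inK x : K x -> `[< B (x, a).2 (x, a).1 >] by move=> /Ka/asboolP.
(* Outside [B a] the section takes the default value [(x0, a)]. *)
pose h (x : weak_space E) : M := insubd (exist _ (x0, a) (inK _ Kx0) : graph) (x : E, a).
have hK x : K x -> val (h x : graph) = (x : E, a).
  by move=> /inK Bx; rewrite /h val_insubd Bx.
exists (h @` K); last first.
  apply/seteqP; split=> [_ [_ [x Kx <-] <-]|x Kx]; first by rewrite /point (hK x Kx).
  by exists (h x); [exists x|rewrite /point (hK x Kx)].
apply: continuous_compact cK => x; apply: cvg_seq_initial => n.
(* Only the subspace topology of [K] is concerned, and there [h x] is the pair [(x, a)]. *)
suff : {within K, continuous (coord n \o h)} by exact.
case nodd: (odd n).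
  apply: (@subspace_eq_continuous _ K R (fun=> (a n./2)%:R)).
    by move=> y /set_mem Ky; rewrite [RHS]/comp /coord nodd hK.
  by move=> y; exact: cvg_cst.
apply: (@subspace_eq_continuous _ K R (d n./2)).
  by move=> y /set_mem Ky; rewrite [RHS]/comp /coord nodd hK.
by apply: continuous_subspaceT; exact: topdual_weak_continuous.
Qed.

Lemma weak_space_aleph0 : hausdorff_space E ->
  \bigcup_a B a = setT ->
  (forall C, tvs_bounded C -> exists a, C `<=` B a) ->
  aleph0_space R (weak_space E).
Proof.
move=> hE Bcover Bswallow; split; first exact: weak_space_tychonoff.
exists M, point; split.
- exact: graph_hausdorff.
- exact: seq_initial_separable.
- exact: point_continuous.
- apply/seteqP; split=> // x _.
  have [a _ ax] : (\bigcup_a B a) x by rewrite Bcover.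
  by exists (exist _ (x : E, a) (asboolT ax) : graph).
- move=> K cK; apply: point_compact_covering => //.
  by apply: Bswallow; exact: weakly_compact_bounded.
Qed.

End bounded_resolution.

Theorem theorem4p4 (R : realType) (E : tvsType R) :
  hausdorff_space E -> quasi_DF E ->
  [/\ separable_space (strong_dual E) -> cosmic R (weak_space E),
      separable_space (strong_dual E) -> strong_dual_barrelled E ->
        aleph0_space R (weak_space E)
    & strict_LF E -> separable_space (strong_dual E) ->
        aleph0_space R (weak_space E)].
Proof.
move=> hE [[B [[B_mono Bcover] B_bounded Bswallow]] _].
have aleph0 : separable_space (strong_dual E) -> aleph0_space R (weak_space E).
  move=> /topdual_dense_sequence[d [d_topdual d_dense]].
  exact: weak_space_aleph0 B_mono B_bounded d_topdual d_dense hE Bcover Bswallow.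
(* Forgetting that the map is compact-covering yields the cosmic property. *)
split=> [/aleph0[tE [M [f [hM sM cf fM _]]]]|sE _|_]; [|exact: aleph0|exact: aleph0].
by split=> //; exists M, f.
Qed.
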